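(* Let $\Delta$ and $\Gamma$ be simplicial complexes on disjoint vertex sets. If $\Delta$ and $\Gamma$ each satisfy the spectral recursion, then so does their join $\Delta*\Gamma=\{F\cup G: F\in\Delta,\ G\in\Gamma\}$ (a simplicial complex on the union of the two vertex sets).
   Context: A simplicial complex $\Delta$ on a finite vertex set $V$ is a collection of subsets of $V$ (faces) closed under taking subsets. The empty set is a face (of dimension $-1$) of every complex that has at least one face; the empty complex $\emptyset$ (no faces at all) is allowed; an element $v\in V$ need not satisfy $\{v\}\in\Delta$. Put $\dim F=|F|-1$. A simplicial pair $(\Delta,\Delta')$ consists of two simplicial complexes on the same vertex set; pairs with the same set difference $\Delta\setminus\Delta'$ are identified, and a single complex $\Delta$ is the pair $(\Delta,\emptyset)$. For $i\ge -1$, $C_i(\Delta,\Delta';\mathbb R)$ is the real vector space of formal linear combinations of oriented $i$-dimensional faces $[F]$, $F\in\Delta\setminus\Delta'$, and $\partial_i\colon C_i\to C_{i-1}$ is the usual signed simplicial boundary operator with all terms outside $\Delta\setminus\Delta'$ dropped; $\partial_i^*$ is its adjoint (transposed matrix in the natural bases). The Laplacian is $L_i(\Delta,\Delta')=\partial_{i+1}\partial_{i+1}^*+\partial_i^*\partial_i$, and $\mathbf s_i(\Delta,\Delta')$ is the multiset of its eigenvalues (non-negative reals). The spectrum polynomial is the generating function $$S_{(\Delta,\Delta')}(t,q)=\sum_{i\ge 0}t^i\sum_{\lambda\in\mathbf s_{i-1}(\Delta,\Delta')}q^\lambda,\qquad S_\Delta=S_{(\Delta,\emptyset)}$$ (exponents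 of $q$ may be arbitrary non-negative reals). For $e\in V$, the deletion $\Delta-e=\{F\in\Delta: e\notin F\}$ and the contraction $\Delta/e=\{F\setminus\{e\}: F\in\Delta,\ e\in F\}$ are simplicial complexes on vertex set $V\setminus\{e\}$. $\Delta$ satisfies the spectral recursion with respect to $e\in V$ if $$S_\Delta(t,q) = q\,S_{\Delta-e}(t,q) + qt\,S_{\Delta/e}(t,q) + (1-q)\,S_{(\Delta-e,\Delta/e)}(t,q),$$ and $\Delta$ satisfies the spectral recursion if this holds for every $e\in V$. *)

(* Defs.v *)
From HB Require Import structures.
From mathcomp Require Import all_boot all_order all_algebra.
From mathcomp Require Import reals polyrcf.
From mathcomp.multinomials Require Import monalg.

Set Implicit Arguments.
Unset Strict Implicit.
Unset Printing Implicit Defensive.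

Import Order.TTheory GRing.Theory Num.Theory.

Local Open Scope ring_scope.

(* The vertices live in an ambient finite type [T]; the vertex set [V] is a
   subset of it.  Elements of [V] need not be faces, and the complex may have
   no face at all. *)
Record complex (T : finType) (V : {set T}) := Complex {
  faces : {set {set T}};
  faces_sub : forall F : {set T}, F \in faces -> F \subset V;
  faces_down : forall F G : {set T}, F \in faces -> G \subset F -> G \in faces
}.

Section Complexes.
Variable T : finType.
Implicit Types (V W : {set T}) (e : T).

Fact void_sub V (F : {set T}) : F \in set0 -> F \subset V.
Proof. by rewrite inE. Qed.

Fact void_down (F G : {set T}) :
  F \in (set0 : {set {set T}}) -> G \subset F -> G \in (set0 : {set {set T}}).
Proof. by rewrite inE. Qed.

Definition void V : complex V := Complex (@void_sub V) void_down.

Section Deletion.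
Variables (V : {set T}) (D : complex V) (e : T).

Definition del_faces := [set F in faces D | e \notin F].

Fact del_sub (F : {set T}) : F \in del_faces -> F \subset V :\ e.
Proof. by rewrite inE subsetD1 => /andP[/faces_sub -> ->]. Qed.

Fact del_down (F G : {set T}) :
  F \in del_faces -> G \subset F -> G \in del_faces.
Proof.
rewrite !inE => /andP[FD eF] GF; rewrite (faces_down FD GF) /=.
by apply: contra eF; apply: (subsetP GF).
Qed.

Definition deletion : complex (V :\ e) := Complex del_sub del_down.

Definition con_faces := [set F :\ e | F in [set F in faces D | e \in F]].

Fact con_sub (F : {set T}) : F \in con_faces -> F \subset V :\ e.
Proof. by case/imsetP=> H; rewrite inE => /andP[/faces_sub HV _] ->; apply: setSD. Qed.

Fact con_down (F G : {set T}) :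
  F \in con_faces -> G \subset F -> G \in con_faces.
Proof.
case/imsetP=> H; rewrite inE => /andP[HD eH] ->; rewrite subsetD1 => /andP[GH eG].
apply/imsetP; exists (e |: G); last by rewrite setU1K.
by rewrite inE setU11 (faces_down HD) // subUset sub1set eH.
Qed.

Definition contraction : complex (V :\ e) := Complex con_sub con_down.

End Deletion.

Section Join.
Variables (V W : {set T}) (D : complex V) (E : complex W).

Definition join_faces := [set F :|: G | F in faces D, G in faces E].

Fact join_sub (F : {set T}) : F \in join_faces -> F \subset V :|: W.
Proof. by case/imset2P=> A B /faces_sub AV /faces_sub BW ->; apply: setUSS. Qed.

Fact join_down (F G : {set T}) :
  F \in join_faces -> G \subset F -> G \in join_faces.
Proof.
case/imset2P=> A B AD BE -> /setIidPl <-; rewrite setIUr.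
by apply: imset2_f; [apply: (faces_down AD) | apply: (faces_down BE)];
  apply: subsetIr.
Qed.

Definition join : complex (V :|: W) := Complex join_sub join_down.

End Join.

End Complexes.

Section Laplacian.
Variables (R : realType) (T : finType) (V : {set T}).

(* The pair [(D, D')] only enters through [faces D :\: faces D'].  The dimension
   is an [int] so that both -1 and -2 (no faces) are treated uniformly. *)
Definition rel_faces (D D' : complex V) (i : int) : {set {set T}} :=
  [set F in faces D :\: faces D' | #|F|%:Z - 1 == i].

Definition vertex_sign (F : {set T}) (x : T) : R :=
  (-1) ^+ #|[set y in F | (enum_rank y < enum_rank x)%N]|.

(* For [j = i - 1] this is the matrix, acting on columns, of the boundary map
   from i-chains to j-chains, in the bases of faces oriented by increasing
   [enum_rank]: the coefficient of [F :\ x] in the boundary of [F] is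
   [vertex_sign F x].  Leaving [j] free avoids a cast between [i + 1 - 1] and
   [i] in the Laplacian. *)
Definition boundary (D D' : complex V) (j i : int) :
    'M[R]_(#|rel_faces D D' j|, #|rel_faces D D' i|) :=
  \matrix_(a < #|rel_faces D D' j|, b < #|rel_faces D D' i|)
    let G : {set T} := enum_val a in
    let F : {set T} := enum_val b in
    \sum_(x in F | G == F :\ x) vertex_sign F x.

Definition laplacian (D D' : complex V) (i : int) :
    'M[R]_#|rel_faces D D' i| :=
  boundary D D' i (i + 1) *m (boundary D D' i (i + 1))^T
  + (boundary D D' (i - 1) i)^T *m boundary D D' (i - 1) i.

End Laplacian.

(* The real eigenvalues of [A], each repeated according to its multiplicity as
   a root of the characteristic polynomial; the order is irrelevant.  This is
   the whole spectrum when [A] is symmetric. *)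
Definition spectrum (R : realType) (n : nat) (A : 'M[R]_n) : seq R :=
  flatten [seq nseq (mup x (char_poly A)) x | x <- rootsR (char_poly A)].

Definition lap_spectrum (R : realType) (T : finType) (V : {set T})
    (D D' : complex V) (i : int) : seq R :=
  spectrum (laplacian R D D' i).

Lemma gram_ge0 (R : realType) (n : nat) (u : 'rV[R]_n) :
  0 <= (u *m u^T) 0 0.
Proof.
by rewrite mxE sumr_ge0 // => k _; rewrite mxE -expr2 sqr_ge0.
Qed.

Lemma gram_eq0 (R : realType) (n : nat) (u : 'rV[R]_n) :
  (u *m u^T) 0 0 = 0 -> u = 0.
Proof.
rewrite mxE => /psumr_eq0P u0; apply/rowP => k; rewrite mxE.
have /u0/(_ k isT) : forall i, true -> 0 <= u 0 i * u^T i 0.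
  by move=> i _; rewrite mxE -expr2 sqr_ge0.
by rewrite mxE => /eqP; rewrite mulf_eq0 orbb => /eqP.
Qed.

Lemma lap_spectrum_ge0 (R : realType) (T : finType) (V : {set T})
    (D D' : complex V) (i : int) (l : R) :
  l \in lap_spectrum R D D' i -> 0 <= l.
Proof.
case/flatten_mapP=> x xroot; rewrite mem_nseq => /andP[_ /eqP ->] {l}.
have: root (char_poly (laplacian R D D' i)) x.
  have p0 := monic_neq0 (char_poly_monic (laplacian R D D' i)).
  by have := roots_on_rootsR p0 x; rewrite xroot => /andP[].
rewrite -eigenvalue_root_char => /eigenvalueP[v vL v0].
have v_gt0 : 0 < (v *m v^T) 0 0.
  by rewrite lt_def gram_ge0 andbT; apply: contra v0 => /eqP/gram_eq0 ->.
rewrite -(pmulr_lge0 _ v_gt0).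
have -> : x * (v *m v^T) 0 0 = (v *m laplacian R D D' i *m v^T) 0 0.
  by rewrite vL -scalemxAl [RHS]mxE.
rewrite /laplacian; set A := boundary _ _ _ _ _; set B := boundary _ _ _ _ _.
have -> : v *m (A *m A^T + B^T *m B) *m v^T
    = (v *m A) *m (v *m A)^T + (v *m B^T) *m (v *m B^T)^T.
  by rewrite !trmx_mul trmxK mulmxDr mulmxDl !mulmxA.
by rewrite mxE addr_ge0 ?gram_ge0.
Qed.

(* Polynomials in t and q with integer coefficients, where q has non-negative
   real exponents: univariate polynomials in t = 'X over the monoid algebra of
   (R>=0, +). *)
Record qexp (R : realType) := QExp { qexp_val : R; _ : 0 <= qexp_val }.

HB.instance Definition _ (R : realType) := [isSub for @qexp_val R].
HB.instance Definition _ (R : realType) := [Choice of qexp R by <:].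

Section QExp.
Variable R : realType.
Implicit Types x y z : qexp R.

Fact qexp_add_ge0 x y : 0 <= val x + val y.
Proof. by rewrite addr_ge0 ?(valP x) ?(valP y). Qed.

Definition qexp0 : qexp R := QExp (lexx 0).
Definition qexp_add x y : qexp R := QExp (qexp_add_ge0 x y).

Fact qexp_addA : associative qexp_add.
Proof. by move=> x y z; apply/val_inj/addrA. Qed.

Fact qexp_add0x : left_id qexp0 qexp_add.
Proof. by move=> x; apply/val_inj/add0r. Qed.

Fact qexp_addx0 : right_id qexp0 qexp_add.
Proof. by move=> x; apply/val_inj/addr0. Qed.

Fact qexp_unit x y : qexp_add x y = qexp0 -> x = qexp0 /\ y = qexp0.
Proof.
move/(congr1 val)/eqP; rewrite /= paddr_eq0 ?(valP x) ?(valP y) //.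
by case/andP=> /eqP x0 /eqP y0; split; apply/val_inj.
Qed.

Fact qexp_addC : commutative qexp_add.
Proof. by move=> x y; apply/val_inj/addrC. Qed.

HB.instance Definition _ := Choice_isMonomialDef.Build (qexp R)
  qexp_addA qexp_add0x qexp_addx0 qexp_unit.
HB.instance Definition _ := MonomialDef_isConomialDef.Build (qexp R) qexp_addC.

(* [q ^ l], meant for [0 <= l] only: the default value of [insubd] is never
   used on Laplacian spectra, by [lap_spectrum_ge0]. *)
Definition qpow (l : R) : {malg int[qexp R]} := << insubd qexp0 l >>.

End QExp.

(* The sum stops at #|V| because no face has more than #|V| vertices. *)
Definition spectrum_poly (R : realType) (T : finType) (V : {set T})
    (D D' : complex V) : {poly {malg int[qexp R]}} :=
  \sum_(i < #|V|.+1)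
    'X^i * \sum_(l <- lap_spectrum R D D' (i%:Z - 1)) (qpow l)%:P.

Definition spectral_recursion_at (R : realType) (T : finType) (V : {set T})
    (D : complex V) (e : T) : Prop :=
  let q : {poly {malg int[qexp R]}} := (qpow 1)%:P in
  let t : {poly {malg int[qexp R]}} := 'X in
  spectrum_poly R D (void V) =
    q * spectrum_poly R (deletion D e) (void (V :\ e))
    + q * t * spectrum_poly R (contraction D e) (void (V :\ e))
    + (1 - q) * spectrum_poly R (deletion D e) (contraction D e).

Definition spectral_recursion (R : realType) (T : finType) (V : {set T})
    (D : complex V) : Prop :=
  forall e : T, e \in V -> spectral_recursion_at R D e.

(* Main.v *)
(* Listing the vertices of F before those of G changes the orientation of the
   face F u G by a sign; in this basis the boundary map of the join is
   d (x) 1 + s (x) d, where s is the degree sign.  Since s anticommutes with d,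
   the mixed terms of the Laplacian cancel and L(A * B) = L(A) (x) 1 + 1 (x) L(B).
   Hence tensor products of eigenvectors are eigenvectors, eigenvalues add, and
   spectrum polynomials are multiplicative under joins, also for pairs.  If e is
   a vertex of the first factor, then deletion, contraction and their difference
   all commute with joining the second factor, so the recursion for the join is
   the recursion for the first factor times the spectrum polynomial of the
   second. *)
From mathcomp Require Import all_boot all_order all_algebra.
From mathcomp Require Import reals ring.
From mathcomp Require Import boolp sesquilinear spectral mxred complex polyrcf.
From mathcomp.multinomials Require Import monalg.
Require Import Defs.

Set Implicit Arguments.
Unset Strict Implicit.
Unset Printing Implicit Defensive.

Import Order.TTheory GRing.Theory Num.Theory.

Local Open Scope ring_scope.

(** * Diagonalization of real symmetric matrices, characteristic polynomials and spectra *)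

(** Over [R[i]] the matrix becomes Hermitian, hence diagonalizable with real eigenvalues; two real
    matrices that are similar over [R[i]] are similar through a real matrix, so the diagonalization
    descends to [R]. *)
Lemma symmetric_diagonalizable (R : rcfType) n (A : 'M[R]_n) :
  A^T = A -> exists2 P, P \in unitmx & exists d, P *m A = diag_mx d *m P.
Proof.
move=> symA; pose toC := real_complex R; pose AC := map_mx toC A.
have realC m1 m2 (M : 'M[R]_(m1, m2)) : map_mx toC M \is a mxOver Num.real.
  by apply/mxOverP => i j; rewrite mxE complex_real.
have hermA : AC \is hermitianmx _ false Num.conj.
  by apply/is_hermitianmxP; rewrite expr0 scale1r /AC map_trmx symA realmxC.
have /orthomx_spectralP ACE := hermitian_normalmx hermA.
have d_real := hermitian_spectral_diag_real hermA.
set PC := spectralmx AC in ACE; set dC := spectral_diag AC in ACE d_real.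
have PCu : PC \in unitmx by apply: spectral_unit.
have sim : similar_in unitmx AC (diag_mx dC).
  exists PC => //; apply/similarP => //.
  by rewrite [in LHS]ACE -mulmxA mulKVmx.
have DC_real : diag_mx dC \is a mxOver Num.real.
  apply/mxOverP => i j; rewrite mxE; case: eqP => _; last by rewrite mulr0n.
  by rewrite mulr1n (mxOverP d_real).
have [Q /andP[Qreal Qu]] := real_similar sim (realC _ _ _) DC_real.
move/(similarP Qu).
have ReK m1 m2 (M : 'M[R[i]]_(m1, m2)) :
    M \is a mxOver Num.real -> M = map_mx toC (map_mx (@complex.Re R) M).
  by move=> /mxOverP Mr; apply/matrixP => i j; rewrite !mxE /toC RRe_real.
rewrite (ReK _ _ _ Qreal) (ReK _ _ _ d_real) -map_diag_mx -!map_mxM.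
move/map_mx_inj => eqQ.
exists (map_mx (@complex.Re R) Q); last by exists (map_mx (@complex.Re R) dC).
by move: Qu; rewrite {1}(ReK _ _ _ Qreal) map_unitmx.
Qed.

(** Take determinants in [P ('X - A) = ('X - B) P] and cancel the nonzero constant [\det P]. *)
Lemma char_poly_intertwine (F : fieldType) n (P A B : 'M[F]_n) :
  P \in unitmx -> P *m A = B *m P -> char_poly A = char_poly B.
Proof.
move=> Pu PA; pose PX := map_mx (@polyC F) P.
have PXA : PX *m char_poly_mx A = char_poly_mx B *m PX.
  by rewrite /char_poly_mx mulmxBr mulmxBl -!map_mxM PA scalar_mxC.
have detPX : \det PX != 0.
  by rewrite det_map_mx polyC_eq0 -unitfE -unitmxE.
by apply: (mulfI detPX); rewrite -det_mulmx PXA det_mulmx mulrC.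
Qed.

Lemma count_mem_flatten_nseq (I : eqType) (m : I -> nat) (r : seq I) x :
  uniq r ->
  count_mem x (flatten [seq nseq (m y) y | y <- r])
  = (if x \in r then m x else 0)%N.
Proof.
elim: r => //= y r IHr /andP[yr ur]; rewrite count_cat IHr // count_nseq /= in_cons.
rewrite [x == y]eq_sym; case: eqP => [<-|_] /=; last by rewrite mul0n.
by rewrite (negPf yr) addn0 mul1n.
Qed.

(** Both sides count [x] by its multiplicity as a root, once the characteristic polynomial
    splits. *)
Lemma perm_spectrum (R : realType) n (A : 'M[R]_n) (s : seq R) :
  char_poly A = \prod_(x <- s) ('X - x%:P) -> perm_eq (spectrum A) s.
Proof.
move=> cA; apply/allP => x _ /=; apply/eqP.
rewrite /spectrum count_mem_flatten_nseq ?uniq_roots // cA mu_prod_XsubC.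
case: ifP => //; have p0 := monic_neq0 (monic_prod_XsubC s xpredT id).
have := roots_on_rootsR p0 x; rewrite root_prod_XsubC andTb => <- /negbT.
by move/count_memPn.
Qed.

Lemma sumr_delta (M : nmodType) (I : finType) (C : {set I}) (f : I -> M) i0 :
  i0 \in C -> \sum_(i in C) f i *+ (i0 == i) = f i0.
Proof.
move=> i0C; rewrite (bigD1 i0) //= eqxx mulr1n big1 ?addr0 // => i /andP[_].
by rewrite eq_sym => /negPf ->.
Qed.

(** * Orientation signs, and the boundary and Laplacian of a join *)

Section FaceFamilies.
Variables (R : realType) (T : finType).
Implicit Types (A B : {set {set T}}) (F G H : {set T}) (V W : {set T}).

(** Pairwise signs make [vertex_sign] a product over the face, which is multiplicative in disjoint
    unions. Since [order_sign x x] is 1, the vertex itself may stay in the product. *)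
Definition order_sign (x y : T) : R := (-1) ^+ (enum_rank y < enum_rank x)%N.

Lemma order_sign_sqr x y : order_sign x y * order_sign x y = 1.
Proof. by rewrite /order_sign -expr2 sqrr_sign. Qed.

Lemma order_sign_sym x y : x != y -> order_sign x y * order_sign y x = -1.
Proof.
move=> xy; rewrite /order_sign; case: ltngtP => [||/val_inj/enum_rank_inj exy].
- by rewrite mulr1.
- by rewrite mul1r.
- by rewrite exy eqxx in xy.
Qed.

Lemma vertex_signE F x : vertex_sign R F x = \prod_(y in F) order_sign x y.
Proof.
rewrite /vertex_sign /order_sign prodrXr; congr (_ ^+ _).
rewrite -sum1_card big_mkcond [RHS]big_mkcond; apply: eq_bigr => y _.
by rewrite inE; case: (y \in F) => //; case: ltnP.
Qed.

(* The sign relating the orientation of [F :|: G] by increasing vertices to the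
   orientation that lists [F] first and [G] second. *)
Definition cross_sign F G : R := \prod_(x in F) \prod_(y in G) order_sign x y.

Lemma cross_sign_sqr F G : cross_sign F G * cross_sign F G = 1.
Proof.
rewrite -big_split big1 // => x _; rewrite -big_split big1 // => y _.
exact: order_sign_sqr.
Qed.

Lemma cross_signE F G : cross_sign F G = \prod_(x in F) vertex_sign R G x.
Proof. by apply: eq_bigr => x _; rewrite vertex_signE. Qed.

Lemma cross_signD1l F G x : x \in F ->
  cross_sign F G = vertex_sign R G x * cross_sign (F :\ x) G.
Proof. by move=> xF; rewrite !cross_signE (big_setD1 x). Qed.

(** Exchanging the arguments of [order_sign] costs a factor -1 for each vertex of [F]; this is the
    origin of the degree sign [(-1) ^+ #|F|] in the boundary of a join. *)
Lemma cross_signD1r F G y : y \in G -> y \notin F ->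
  cross_sign F G = (-1) ^+ #|F| * vertex_sign R F y * cross_sign F (G :\ y).
Proof.
move=> yG yF; rewrite vertex_signE -prodr_const -!big_split /=.
apply: eq_bigr => x xF; rewrite (big_setD1 y) //=; congr (_ * _).
have xy : x != y by apply: contraNneq yF => <-.
by rewrite -(order_sign_sym xy) -mulrA order_sign_sqr mulr1.
Qed.

Lemma vertex_signU F G x : [disjoint F & G] ->
  vertex_sign R (F :|: G) x = vertex_sign R F x * vertex_sign R G x.
Proof.
move=> FG; rewrite !vertex_signE -bigU //.
by apply: eq_bigl => y; rewrite !inE.
Qed.

Definition face_boundary G F : R :=
  \sum_(x in F | G == F :\ x) vertex_sign R F x.

Lemma face_boundary_card G F : face_boundary G F != 0 -> #|F| = #|G|.+1.
Proof.
apply: contra_neq_eq => FG; rewrite /face_boundary big1 // => x /andP[xF /eqP GE].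
by rewrite (cardsD1 x F) xF -GE eqxx in FG.
Qed.

(** One kernel for the Laplacians of all dimensions: [H] may range over all of [A], because
    [face_boundary] vanishes unless the cardinalities differ by one. The dimensions then appear as
    diagonal blocks. *)
Definition face_laplacian A F F' : R :=
  \sum_(H in A) (face_boundary F H * face_boundary F' H
                 + face_boundary H F * face_boundary H F').

Lemma face_laplacian_sym A F F' : face_laplacian A F F' = face_laplacian A F' F.
Proof. by apply: eq_bigr => H _; rewrite mulrC [X in _ + X]mulrC. Qed.

Lemma face_laplacian_graded A F F' :
  #|F| != #|F'| -> face_laplacian A F F' = 0.
Proof.
move=> FF'; rewrite /face_laplacian big1 // => H _.
rewrite [X in X + _](_ : _ = 0) ?add0r.
  apply/eqP; apply: contraNT FF'; rewrite mulf_eq0 negb_or.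
  by case/andP=> /face_boundary_card-> /face_boundary_card->.
apply/eqP; apply: contraNT FF'; rewrite mulf_eq0 negb_or.
by case/andP=> /face_boundary_card + /face_boundary_card => -> [->].
Qed.

(** Arbitrary families are allowed because the difference set of a pair is in general not closed
    under subsets. *)
Definition family_join A B : {set {set T}} := [set F :|: G | F in A, G in B].

Section Join.
Variables (A B : {set {set T}}) (V W : {set T}).
Hypothesis VW : [disjoint V & W].
Hypotheses (AV : {in A, forall F, F \subset V}).
Hypotheses (BW : {in B, forall G, G \subset W}).

Lemma setUIl_disjoint F G : F \subset V -> G \subset W -> (F :|: G) :&: V = F.
Proof.
move=> FV GW; rewrite setIUl (setIidPl FV).
by rewrite (disjoint_setI0 (disjointWl GW _)) ?setU0 // disjoint_sym.
Qed.

Lemma setUIr_disjoint F G : F \subset V -> G \subset W -> (F :|: G) :&: W = G.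
Proof.
move=> FV GW; rewrite setIUl (setIidPl GW).
by rewrite (disjoint_setI0 (disjointWl FV _)) ?set0U.
Qed.

Lemma big_family_join (M : nmodType) (f : {set T} -> M) :
  \sum_(H in family_join A B) f H = \sum_(F in A) \sum_(G in B) f (F :|: G).
Proof.
rewrite /family_join curry_imset2X big_imset /=; last first.
  move=> [F G] [F' G']; rewrite !inE /=.
  move=> /andP[/AV FV /BW GW] /andP[/AV FV' /BW GW'] FG; congr (_, _).
    by rewrite -(setUIl_disjoint FV GW) FG setUIl_disjoint.
  by rewrite -(setUIr_disjoint FV GW) FG setUIr_disjoint.
by rewrite pair_big /=; apply: eq_big => -[F G] //=; rewrite !inE.
Qed.

Lemma sum_family_joinM (S : pzSemiRingType) (f g h : {set T} -> S) :
  {in A & B, forall F G, h (F :|: G) = f F * g G} ->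
  \sum_(H in family_join A B) h H = (\sum_(F in A) f F) * (\sum_(G in B) g G).
Proof.
move=> hM; rewrite big_family_join big_distrlr; apply: eq_bigr => F FA.
by apply: eq_bigr => G GB; apply: hM.
Qed.

Lemma setU_disjoint_eq F G F' G' :
  F \subset V -> G \subset W -> F' \subset V -> G' \subset W ->
  (F :|: G == F' :|: G') = (F == F') && (G == G').
Proof.
move=> FV GW FV' GW'; apply/eqP/andP => [FG|[/eqP-> /eqP->] //]; split; apply/eqP.
  by rewrite -(setUIl_disjoint FV GW) FG setUIl_disjoint.
by rewrite -(setUIr_disjoint FV GW) FG setUIr_disjoint.
Qed.

(** The vertex removed from [F' :|: G'] lies in [F'] or in [G'], which gives the two summands. The
    factor that the other face contributes to the vertex sign is absorbed by the recursion for
    [cross_sign]. *)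
Lemma face_boundary_join F G F' G' :
  F \subset V -> G \subset W -> F' \subset V -> G' \subset W ->
  face_boundary (F :|: G) (F' :|: G') =
  cross_sign F G * cross_sign F' G' *
  (face_boundary F F' *+ (G == G')
   + (-1) ^+ #|F'| * face_boundary G G' *+ (F == F')).
Proof.
move=> FV GW FV' GW'.
have dFG' : [disjoint F' & G'] by apply: disjointWl FV' (disjointWr GW' VW).
rewrite [LHS]/face_boundary (eq_bigl (fun x => (x \in [predU F' & G'])
   && (F :|: G == (F' :|: G') :\ x))); last by move=> x; rewrite !inE.
rewrite big_mkcondr bigU //= mulrDr; congr (_ + _).
  rewrite /face_boundary [X in _ = _ * (X *+ _)]big_mkcondr -sumrMnl mulr_sumr.
  apply: eq_bigr => x xF'.
  have xG' : x \notin G' by rewrite (disjointFr dFG').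
  have -> : (F' :|: G') :\ x = F' :\ x :|: G'.
    rewrite setDUl; congr (_ :|: _); apply/setDidPl.
    by rewrite disjoint_sym disjoints1.
  rewrite setU_disjoint_eq // ?(subset_trans (subsetDl _ _)) // andbC.
  case: (eqVneq G G') => [->|_] /=; last by rewrite mulr0n mulr0.
  rewrite mulr1n; case: eqP => [->|_]; last by rewrite mulr0.
  rewrite vertex_signU // (cross_signD1l _ xF').
  by rewrite mulrCA cross_sign_sqr mulr1 mulrC.
rewrite /face_boundary [X in _ * X *+ _]big_mkcondr mulr_sumr -sumrMnl mulr_sumr.
apply: eq_bigr => x xG'.
have xF' : x \notin F' by rewrite (disjointFl dFG').
have -> : (F' :|: G') :\ x = F' :|: G' :\ x.
  rewrite setDUl; congr (_ :|: _); apply/setDidPl.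
  by rewrite disjoint_sym disjoints1.
rewrite setU_disjoint_eq // ?(subset_trans (subsetDl _ _)) //.
case: (eqVneq F F') => [->|_] /=; last by rewrite mulr0n mulr0.
rewrite mulr1n; case: eqP => [->|_]; last by rewrite !mulr0.
rewrite vertex_signU // (cross_signD1r xG' xF').
rewrite [cross_sign _ _ * _]mulrCA cross_sign_sqr mulr1.
by rewrite mulrACA -expr2 sqrr_sign mul1r.
Qed.

(* The mixed terms of [L] cancel since the sign [(-1) ^+ #|F|] anticommutes with
   the boundary of the first factor. *)
Lemma face_laplacian_join F G F' G' :
  F \in A -> G \in B -> F' \in A -> G' \in B ->
  face_laplacian (family_join A B) (F :|: G) (F' :|: G') =
  cross_sign F G * cross_sign F' G' *
  (face_laplacian A F F' *+ (G == G') + face_laplacian B G G' *+ (F == F')).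
Proof.
move=> FA GB FA' GB'.
have [FV GW FV' GW'] := And4 (AV FA) (BW GB) (AV FA') (BW GB').
pose a F1 F2 := face_boundary F1 F2; pose s F1 : R := (-1) ^+ #|F1|.
(* [X] collects the terms where [H1 :|: H2] is a coface (up-Laplacian), [Y] those where it is a
   facet (down-Laplacian). *)
pose X H1 H2 := (a F H1 *+ (G == H2) + s H1 * a G H2 *+ (F == H1))
  * (a F' H1 *+ (G' == H2) + s H1 * a G' H2 *+ (F' == H1)).
pose Y H1 H2 := (a H1 F *+ (G == H2) + s F * a H2 G *+ (F == H1))
  * (a H1 F' *+ (G' == H2) + s F' * a H2 G' *+ (F' == H1)).
rewrite /face_laplacian big_family_join.
transitivity (cross_sign F G * cross_sign F' G' *
    \sum_(H1 in A) \sum_(H2 in B) (X H1 H2 + Y H1 H2)).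
  rewrite mulr_sumr; apply: eq_bigr => H1 /AV H1V.
  rewrite mulr_sumr; apply: eq_bigr => H2 /BW H2W.
  rewrite !face_boundary_join // /X /Y /a /s.
  rewrite ![H1 == _]eq_sym ![H2 == _]eq_sym.
  (* The orientation sign of the summation face [H1 :|: H2] occurs twice and squares to 1. *)
  rewrite [RHS]mulrDr; congr (_ + _); rewrite mulrACA; congr (_ * _).
    by rewrite mulrACA cross_sign_sqr mulr1.
  by rewrite mulrACA cross_sign_sqr mul1r.
congr (_ * _); under eq_bigr do rewrite big_split; rewrite big_split /=.
(* Of the four products, the two pure ones lose one sum to a delta and keep a delta on the other
   factor; in the two mixed ones both sums collapse. *)
have expand (p p' u u' q q' : {set T} -> R) :
    \sum_(H1 in A) \sum_(H2 in B) (p H1 *+ (G == H2) + u H1 * q H2 *+ (F == H1))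
      * (p' H1 *+ (G' == H2) + u' H1 * q' H2 *+ (F' == H1)) =
    (\sum_(H1 in A) p H1 * p' H1) *+ (G == G') + p F' * (u' F' * q' G)
    + (u F * q G' * p' F
       + (\sum_(H2 in B) u F * q H2 * (u' F * q' H2)) *+ (F == F')).
  under eq_bigr => H1 _ do
    (under eq_bigr => H2 _ do rewrite mulrDl !mulrDr; rewrite !big_split /=).
  rewrite !big_split /=; congr (_ + _ + (_ + _)).
  - rewrite -sumrMnl; apply: eq_bigr => H1 _.
    under eq_bigr => H2 _ do rewrite mulrnAl mulrnAr.
    by rewrite sumr_delta // eq_sym.
  - under eq_bigr => H1 _ do
      (under eq_bigr => H2 _ do rewrite mulrnAl mulrnAr; rewrite sumr_delta //).
    by rewrite sumr_delta.
  - under eq_bigr => H1 _ do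
      (under eq_bigr => H2 _ do rewrite mulrnAr mulrnAl; rewrite sumr_delta //).
    by rewrite sumr_delta.
  - rewrite exchange_big -sumrMnl /=; apply: eq_bigr => H2 _.
    under eq_bigr => H1 _ do rewrite mulrnAl mulrnAr.
    by rewrite sumr_delta // eq_sym.
rewrite /X /Y !expand.
have s2 : s F * s F = 1 by rewrite /s -expr2 sqrr_sign.
(* A nonzero boundary coefficient forces cardinalities differing by one, hence opposite degree
   signs. *)
have cross1 : s F * a F F' = - (s F' * a F F').
  have [->|/face_boundary_card FF'] := eqVneq (a F F') 0.
    by rewrite !mulr0 oppr0.
  by rewrite /s FF' exprS mulN1r mulNr opprK.
have cross2 : s F * a F' F = - (s F' * a F' F).
  have [->|/face_boundary_card FF'] := eqVneq (a F' F) 0.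
    by rewrite !mulr0 oppr0.
  by rewrite /s FF' exprS mulN1r mulNr.
rewrite !big_split /= !mulrnDl.
have mixed1 : s F * a G' G * a F F' = - (a F F' * (s F' * a G' G)).
  by rewrite mulrAC cross1; ring.
have mixed2 : s F * a G G' * a F' F = - (a F' F * (s F' * a G G')).
  by rewrite mulrAC cross2; ring.
have squareB1 : \sum_(H2 in B) s F * a G H2 * (s F * a G' H2)
    = \sum_(H2 in B) a G H2 * a G' H2.
  by apply: eq_bigr => H2 _; rewrite mulrACA s2 mul1r.
(* Here the signs belong to [F] and [F'], so their product is 1 only thanks to the delta on
   [F == F']. *)
have squareB2 : (\sum_(H2 in B) s F * a H2 G * (s F' * a H2 G')) *+ (F == F')
    = (\sum_(H2 in B) a H2 G * a H2 G') *+ (F == F').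
  case: eqVneq => [<-|_]; last by rewrite !mulr0n.
  by congr (_ *+ _); apply: eq_bigr => H2 _; rewrite mulrACA s2 mul1r.
rewrite mixed1 mixed2 squareB1 squareB2 -/(a _ _).
move: (a F F' * _) (a F' F * _) => m1 m2.
move: (_ *+ (G == G')) (_ *+ (G == G')) (_ *+ (F == F')) (_ *+ (F == F')).
by move=> x1 x2 x3 x4; ring.
Qed.

End Join.
End FaceFamilies.

(** * Eigenvector bases indexed by faces, and their tensor products *)

(** Diagonalization for kernels on a finite set, free of ordinal indices. The data form a single
    triple so that [choice] can pick one for every cardinality at once. *)
Lemma symmetric_kernel_diagonalizable (R : rcfType) (I : finType) (B : {set I})
    (K : I -> I -> R) :
  (forall x y, K x y = K y x) ->
  exists PQd : (I -> I -> R) * (I -> I -> R) * (I -> R),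
    let: (P, Q, d) := PQd in
    {in B &, forall a b, \sum_(x in B) P a x * Q x b = (a == b)%:R} /\
    {in B &, forall a y, \sum_(x in B) P a x * K x y = d a * P a y}.
Proof.
(* The empty set is treated apart because [enum_rank_in] needs an element of [B]. *)
move=> symK; have [->|[x0 x0B]] := set_0Vmem B.
  by exists (fun _ _ => 0, fun _ _ => 0, fun=> 0); split=> a b; rewrite inE.
pose M := \matrix_(i < #|B|, j < #|B|) K (enum_val i) (enum_val j).
have symM : M^T = M by apply/matrixP => i j; rewrite !mxE.
have [P Pu [d PM]] := symmetric_diagonalizable symM.
pose r := enum_rank_in x0B.
exists (fun x y => P (r x) (r y), fun x y => invmx P (r x) (r y),
        fun x => d 0 (r x)).
split=> a b aB bB; rewrite big_enum_val.
  under eq_bigr => i _ do rewrite /r enum_valK_in.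
  have /matrixP/(_ (r a) (r b)) := mulmxV Pu; rewrite !mxE => ->.
  by rewrite (inj_in_eq (can_in_inj (enum_rankK_in x0B (A := _)))).
under eq_bigr => i _ do rewrite /r enum_valK_in.
have /matrixP/(_ (r a) (r b)) := PM; rewrite mul_diag_mx !mxE => <-.
by apply: eq_bigr => i _; rewrite mxE enum_rankK_in.
Qed.

Section Eigenvalues.
Variables (R : realType) (T : finType).
Implicit Types (A B : {set {set T}}) (a b F G : {set T}) (d e : {set T} -> R).

(* [P] is the invertible matrix, with inverse [Q], whose row [a] is an
   eigenvector for [d a]; eigenvectors are themselves indexed by faces, those of
   degree [#|a|] being supported on the faces with [#|a|] vertices. *)
Definition laplacian_eigenvalues A d : Prop :=
  exists P Q : {set T} -> {set T} -> R,
  [/\ {in A &, forall a F, #|a| != #|F| -> P a F = 0},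
      {in A &, forall a b, \sum_(F in A) P a F * Q F b = (a == b)%:R}
    & {in A &, forall a F,
        \sum_(G in A) P a G * face_laplacian R A G F = d a * P a F}].

(** Diagonalize each block of faces of equal cardinality and glue the results into a block-diagonal
    [P]; the kernel has no entries between different blocks. *)
Lemma laplacian_eigenvalues_exist A : exists d, laplacian_eigenvalues A d.
Proof.
have [PQd PQdE] := choice (fun n : nat => symmetric_kernel_diagonalizable
  [set F in A | #|F| == n] (face_laplacian_sym R A)).
pose P a F := if #|a| == #|F| then (PQd #|a|).1.1 a F else 0.
have sumP a (f : {set T} -> R) :
    \sum_(F in A) P a F * f F
    = \sum_(F in [set F in A | #|F| == #|a|]) (PQd #|a|).1.1 a F * f F.
  rewrite [RHS](eq_bigl (fun F => (F \in A) && (#|F| == #|a|))) ?big_mkcondr.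
    apply: eq_bigr => F _; rewrite /P eq_sym.
    by case: eqP => _ //; rewrite mul0r.
  by move=> F; rewrite inE.
exists (fun a => (PQd #|a|).2 a), P,
  (fun F b => if #|F| == #|b| then (PQd #|b|).1.2 F b else 0).
split=> [a F _ _|a b aA bA|a F aA FA]; first by rewrite /P => /negPf ->.
- rewrite sumP; have [ab|ab] := eqVneq #|a| #|b|.
    move: (PQdE #|a|); case E: (PQd #|a|) => [[p q] e] /= [PQ _].
    rewrite -ab E /= -(PQ a b) ?inE ?aA ?bA ?ab ?eqxx //.
    by apply: eq_bigr => F; rewrite inE -ab => /andP[_ ->].
  rewrite big1 => [|F]; last first.
    by rewrite inE => /andP[_ /eqP->]; rewrite (negPf ab) mulr0.
  by have [eab|//] := eqVneq a b; rewrite eab eqxx in ab.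
- rewrite sumP /P; have [aF|aF] := eqVneq #|a| #|F|.
    move: (PQdE #|a|); case: (PQd #|a|) => [[p q] e] /= [_ Pd].
    by rewrite Pd ?inE ?aA ?FA ?aF ?eqxx.
  rewrite mulr0 big1 // => G; rewrite inE => /andP[_ /eqP Ga].
  by rewrite face_laplacian_graded ?mulr0 // Ga.
Qed.

(** The witnesses are tensor products of those of the factors, twisted by [cross_sign] of the face;
    since this sign squares to 1, the same twist serves [P] and its inverse. Intersecting with [V]
    and [W] recovers the two factors of a face. *)
Lemma laplacian_eigenvalues_join A B (V W : {set T}) d e :
  [disjoint V & W] ->
  {in A, forall F, F \subset V} -> {in B, forall G, G \subset W} ->
  laplacian_eigenvalues A d -> laplacian_eigenvalues B e ->
  laplacian_eigenvalues (family_join A B) (fun H => d (H :&: V) + e (H :&: W)).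
Proof.
move=> VW AV BW [PA [QA [gradA PQA eigA]]] [PB [QB [gradB PQB eigB]]].
have cap F G : F \in A -> G \in B ->
    ((F :|: G) :&: V = F) * ((F :|: G) :&: W = G).
  by move=> /AV FV /BW GW; rewrite (setUIl_disjoint VW) ?(setUIr_disjoint VW).
have cardU F G : F \subset V -> G \subset W -> #|F :|: G| = (#|F| + #|G|)%N.
  move=> FV GW; rewrite cardsU disjoint_setI0 ?cards0 ?subn0 //.
  exact: disjointWl FV (disjointWr GW VW).
exists (fun a F => cross_sign R (F :&: V) (F :&: W)
   * (PA (a :&: V) (F :&: V) * PB (a :&: W) (F :&: W))),
 (fun F a => cross_sign R (F :&: V) (F :&: W)
   * (QA (F :&: V) (a :&: V) * QB (F :&: W) (a :&: W))).
split=> _ _ /imset2P[a b aA bB ->] /imset2P[a' b' aA' bB' ->].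
- rewrite !cap // !cardU ?AV ?BW // => ab.
  have [/gradA ->|aa'] := boolP (#|a| != #|a'|); rewrite ?mul0r ?mulr0 //.
  have [/gradB ->|bb'] := boolP (#|b| != #|b'|); rewrite ?mulr0 //.
  by move: aa' bb'; rewrite !negbK => /eqP aa' /eqP bb'; rewrite aa' bb' eqxx in ab.
- rewrite (big_family_join VW AV BW).
  rewrite (setU_disjoint_eq VW (AV _ aA) (BW _ bB) (AV _ aA') (BW _ bB')).
  rewrite -mulnb natrM.
  rewrite -PQA // -PQB // big_distrlr /=.
  apply: eq_bigr => F FA; apply: eq_bigr => G GB.
  rewrite !cap // mulrACA cross_sign_sqr mul1r.
  by rewrite mulrACA.
rename a' into F', b' into G', aA' into FA', bB' into GB'.
rewrite (big_family_join VW AV BW) !cap //.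
(* The sign of the summation face cancels; that of the target face factors out. *)
transitivity (cross_sign R F' G' *
   \sum_(F in A) \sum_(G in B) (PA a F * PB b G *
     (face_laplacian R A F F' *+ (G == G')
      + face_laplacian R B G G' *+ (F == F')))).
  rewrite mulr_sumr; apply: eq_bigr => F FA.
  rewrite mulr_sumr; apply: eq_bigr => G GB.
  rewrite !cap // (face_laplacian_join R VW AV BW) //.
  move: (cross_sign_sqr R F G) (_ *+ _ + _) => sq1 L.
  by rewrite -[RHS]mul1r -sq1; ring.
have delta (C : {set {set T}}) (f : {set T} -> R) F0 :
    F0 \in C -> \sum_(H in C) f H *+ (H == F0) = f F0.
  by move=> F0C; under eq_bigr do rewrite eq_sym; apply: sumr_delta.
rewrite [RHS]mulrCA; congr (_ * _).
under eq_bigr do (under eq_bigr do rewrite mulrDr; rewrite big_split /=).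
rewrite big_split mulrDl /=; congr (_ + _).
  rewrite mulrA -eigA // mulr_suml; apply: eq_bigr => F FA.
  under eq_bigr do rewrite mulrnAr.
  by rewrite delta // mulrAC.
rewrite mulrCA -eigB // exchange_big mulr_sumr /=; apply: eq_bigr => G GB.
under eq_bigr do rewrite mulrnAr.
by rewrite delta // mulrA.
Qed.

End Eigenvalues.

(** * From Laplacian matrices to the spectrum polynomial as a sum over faces *)

Lemma big_enum_val_set (S : Type) (idx : S) (op : Monoid.com_law idx)
    (I : finType) (B : {set I}) (f : I -> S) :
  \big[op/idx]_(i < #|B|) f (enum_val i) = \big[op/idx]_(x in B) f x.
Proof. by rewrite [RHS]big_enum_val. Qed.

Lemma mem_rel_faces (T : finType) (V : {set T}) (D D' : complex V)
    (F : {set T}) (n : nat) :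
  (F \in rel_faces D D' (n%:Z - 1)) = (F \in faces D :\: faces D') && (#|F| == n).
Proof. by rewrite inE (inj_eq (addIr _)) eqz_nat. Qed.

(** The matrix products run only over faces of dimension [i + 1] and [i - 1]; the further terms of
    the kernel vanish by [face_boundary_card]. *)
Lemma laplacianE (R : realType) (T : finType) (V : {set T}) (D D' : complex V) i
    (a b : 'I_#|rel_faces D D' i|) :
  laplacian R D D' i a b =
  face_laplacian R (faces D :\: faces D') (enum_val a) (enum_val b).
Proof.
have card_val (c : 'I_#|rel_faces D D' i|) : #|enum_val c|%:Z - 1 = i.
  by have := enum_valP c; rewrite inE => /andP[_ /eqP].
rewrite !mxE /face_laplacian [RHS]big_split /=; congr (_ + _).
  under eq_bigr => c _ do rewrite !mxE -!/(face_boundary R _ _).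
  rewrite (big_enum_val_set _ (rel_faces D D' (i + 1)) (fun H : {set T} =>
    face_boundary R (enum_val a) H * face_boundary R (enum_val b) H)).
  rewrite (eq_bigl (fun H =>
    (H \in faces D :\: faces D') && (#|H|%:Z - 1 == i + 1)));
    last by move=> H; rewrite inE.
  rewrite big_mkcondr; apply: eq_bigr => H _; case: ifP => // /eqP cardH.
  apply/eqP; rewrite eq_sym mulf_eq0; apply/orP; left.
  apply/negPn/negP => /face_boundary_card aH; apply: cardH.
  rewrite aH; move: #|enum_val a| (card_val a) => k <-.
  by rewrite -addn1 PoszD; ring.
under eq_bigr => c _ do rewrite !mxE -!/(face_boundary R _ _).
rewrite (big_enum_val_set _ (rel_faces D D' (i - 1)) (fun H : {set T} =>
  face_boundary R H (enum_val a) * face_boundary R H (enum_val b))).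
rewrite (eq_bigl (fun H =>
  (H \in faces D :\: faces D') && (#|H|%:Z - 1 == i - 1)));
  last by move=> H; rewrite inE.
rewrite big_mkcondr; apply: eq_bigr => H _; case: ifP => // /eqP cardH.
apply/eqP; rewrite eq_sym mulf_eq0; apply/orP; left.
apply/negPn/negP => /face_boundary_card aH; apply: cardH.
by have := card_val a; rewrite aH => <-; rewrite -addn1 PoszD; ring.
Qed.

Section SpectrumPoly.
Variables (R : realType) (T : finType) (V : {set T}) (D D' : complex V).
Variable (d : {set T} -> R).
Hypothesis d_eigen : laplacian_eigenvalues (faces D :\: faces D') d.

(** As [P] is graded, its restriction to the faces with [n] vertices is still invertible and
    conjugates the Laplacian to the diagonal matrix of the [d F]. *)
Lemma perm_lap_spectrum n :
  perm_eq (lap_spectrum R D D' (n%:Z - 1))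
          [seq d F | F <- enum (rel_faces D D' (n%:Z - 1))].
Proof.
have [P [Q [gradP PQ eigP]]] := d_eigen; set B := rel_faces _ _ _.
have memB F : F \in B -> (F \in faces D :\: faces D') * (#|F| = n).
  by rewrite mem_rel_faces => /andP[-> /eqP].
pose PM := \matrix_(i < #|B|, j < #|B|) P (enum_val i) (enum_val j).
pose QM := \matrix_(i < #|B|, j < #|B|) Q (enum_val i) (enum_val j).
have sumP a (f : {set T} -> R) : a \in B ->
    \sum_(i < #|B|) P a (enum_val i) * f (enum_val i)
    = \sum_(F in faces D :\: faces D') P a F * f F.
  move=> aB; rewrite (big_enum_val_set _ B (fun F => P a F * f F)).
  rewrite (eq_bigl (fun F => (F \in faces D :\: faces D') && (#|F| == n)));
    last by move=> F; rewrite -mem_rel_faces.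
  rewrite big_mkcondr; apply: eq_bigr => F FA; case: ifP => // /negbT Fn.
  by rewrite gradP ?mul0r ?(memB a aB) // eq_sym.
have PQM : PM *m QM = 1%:M.
  apply/matrixP => i j; rewrite !mxE; under eq_bigr => k _ do rewrite !mxE.
  have [iA _] := memB _ (enum_valP i); have [jA _] := memB _ (enum_valP j).
  rewrite (sumP _ (Q^~ (enum_val j))) ?enum_valP // PQ //.
  by rewrite (inj_eq enum_val_inj).
have [PMu _] := mulmx1_unit PQM.
have PML : PM *m laplacian R D D' (n%:Z - 1)
    = diag_mx (\row_i d (enum_val i)) *m PM.
  apply/matrixP => i j; rewrite mul_diag_mx !mxE.
  under eq_bigr => k _ do rewrite laplacianE mxE.
  have [iA _] := memB _ (enum_valP i); have [jA _] := memB _ (enum_valP j).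
  by rewrite (sumP _ (face_laplacian R _ ^~ (enum_val j))) ?enum_valP // eigP.
apply: perm_spectrum; rewrite (char_poly_intertwine PMu PML).
rewrite char_poly_trig ?diag_mx_is_trig // big_map big_enum -big_enum_val_set.
by apply: eq_bigr => i _; rewrite !mxE eqxx mulr1n.
Qed.

Lemma laplacian_eigenvalue_ge0 F : F \in faces D :\: faces D' -> 0 <= d F.
Proof.
move=> FA; apply: (@lap_spectrum_ge0 R T V D D' (#|F|%:Z - 1)).
by rewrite (perm_mem (perm_lap_spectrum _)) map_f // mem_enum mem_rel_faces FA eqxx.
Qed.

(** Grouping faces by cardinality merges all dimensions into one sum, so that multiplicativity
    reduces to distributing a product of two sums. *)
Lemma spectrum_polyE :
  spectrum_poly R D D' = \sum_(F in faces D :\: faces D') 'X^#|F| * (qpow (d F))%:P.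
Proof.
have cardF F : F \in faces D :\: faces D' -> (#|F| < #|V|.+1)%N.
  by rewrite ltnS => /setDP[/faces_sub/subset_leq_card].
(* [inord] never falls back to its default: a face has at most [#|V|] vertices. *)
rewrite (partition_big (fun F : {set T} => inord #|F| : 'I_#|V|.+1) xpredT) //=.
apply: eq_bigr => i _; rewrite mulr_sumr (perm_big _ (perm_lap_spectrum i)).
rewrite big_map big_enum /=.
apply: eq_big => F; first rewrite mem_rel_faces.
  by apply: andb_id2l => /cardF Fn; rewrite -val_eqE /= inordK.
by rewrite mem_rel_faces => /andP[_ /eqP ->].
Qed.

End SpectrumPoly.

(** * Multiplicativity under joins and the spectral recursion *)

Lemma qpowD (R : realType) (x y : R) :
  0 <= x -> 0 <= y -> qpow (x + y) = qpow x * qpow y.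
Proof.
move=> x0 y0; rewrite /qpow malgM_def fgmulUU mulr1; congr (<< _ >>).
by apply: val_inj; rewrite /= !insubdK // -topredE /= ?addr_ge0.
Qed.

(** The vertex set [U] is left free because only the difference set matters; this avoids casts
    between equal sets such as [(V :|: W) :\ e] and [(V :\ e) :|: W]. *)
Lemma spectrum_poly_join (R : realType) (T : finType) (V W U : {set T})
    (D D' : complex V) (E E' : complex W) (J J' : complex U) :
  [disjoint V & W] ->
  faces J :\: faces J'
    = family_join (faces D :\: faces D') (faces E :\: faces E') ->
  spectrum_poly R J J' = spectrum_poly R D D' * spectrum_poly R E E'.
Proof.
move=> VW JE.
have subC (X : {set T}) (C C' : complex X) :
    {in faces C :\: faces C', forall F : {set T}, F \subset X}.
  by move=> F /setDP[/faces_sub].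
have [d d_eig] := laplacian_eigenvalues_exist R (faces D :\: faces D').
have [e e_eig] := laplacian_eigenvalues_exist R (faces E :\: faces E').
have := laplacian_eigenvalues_join VW (subC V D D') (subC W E E') d_eig e_eig.
rewrite -JE => j_eig.
rewrite (spectrum_polyE j_eig) (spectrum_polyE d_eig) (spectrum_polyE e_eig).
rewrite JE.
apply: (sum_family_joinM VW (subC V D D') (subC W E E')) => F G FA GB.
have FV := subC _ _ _ F FA; have GW := subC _ _ _ G GB.
rewrite (setUIl_disjoint VW) // (setUIr_disjoint VW) //.
rewrite qpowD ?(laplacian_eigenvalue_ge0 d_eig) //;
  last exact: laplacian_eigenvalue_ge0 e_eig _ GB.
rewrite cardsU disjoint_setI0 ?cards0 ?subn0; last first.
  exact: disjointWl FV (disjointWr GW VW).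
by rewrite exprD polyCM -!mulrA; congr (_ * _); rewrite !mulrA commr_polyXn.
Qed.

(** As [e] lies in no face of [E], removing it affects the first factor only. Taking any [J] with
    the right faces lets the lemma serve for vertices of either factor. *)
Lemma spectral_recursion_at_join (R : realType) (T : finType) (V W U : {set T})
    (D : complex V) (E : complex W) (J : complex U) (e : T) :
  [disjoint V & W] -> faces J = family_join (faces D) (faces E) -> e \in V ->
  spectral_recursion_at R D e -> spectral_recursion_at R J e.
Proof.
move=> VW JE eV.
have eE G : G \in faces E -> e \notin G.
  move=> /faces_sub /subsetP GW; apply: contraL eV => /GW eW.
  by rewrite (disjointFl VW eW).
have VeW : [disjoint V :\ e & W] by apply: disjointWl VW; apply: subsetDl.
have delJ : faces (deletion J e) = family_join (faces (deletion D e)) (faces E).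
  apply/setP => H; rewrite inE JE; apply/andP/imset2P.
    case=> /imset2P[F G FD GE ->]; rewrite inE negb_or => /andP[eF eG].
    by exists F G => //; rewrite inE FD.
  case=> F G; rewrite inE => /andP[FD eF] GE ->.
  by rewrite imset2_f // inE negb_or eF eE.
have conJ :
    faces (contraction J e) = family_join (faces (contraction D e)) (faces E).
  have setUD1 F G : G \in faces E -> (F :|: G) :\ e = F :\ e :|: G.
    by move=> GE; rewrite setDUl; congr (_ :|: _); apply/setDidPl;
       rewrite disjoint_sym disjoints1 eE.
  apply/setP => H; apply/imsetP/imset2P.
    case=> X; rewrite inE JE => /andP[/imset2P[F G FD GE ->]].
    rewrite inE (negPf (eE _ GE)) orbF => eF ->; exists (F :\ e) G => //.
      by apply/imsetP; exists F => //; rewrite inE FD.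
    exact: setUD1.
  case=> _ G /imsetP[F + ->] GE ->; rewrite inE => /andP[FD eF].
  by exists (F :|: G); rewrite ?setUD1 // inE JE imset2_f // inE eF.
(* Differences commute with the join because a face determines its two factors. *)
have joinD (A A' B : {set {set T}}) :
    {in A, forall F : {set T}, F \subset V :\ e} ->
    {in A', forall F : {set T}, F \subset V :\ e} ->
    {in B, forall G : {set T}, G \subset W} ->
    family_join A B :\: family_join A' B = family_join (A :\: A') B.
  move=> AV AV' BW; apply/setP => H; apply/setDP/imset2P.
    case=> /imset2P[F G FA GB ->] FG; exists F G => //; rewrite inE FA andbT.
    by apply: contra FG => FA'; apply: imset2_f.
  case=> F G /setDP[FA FA'] GB ->; split; first exact: imset2_f.
  apply: contra FA' => /imset2P[F' G' FA' GB'] /eqP.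
  rewrite (setU_disjoint_eq VeW (AV _ FA) (BW _ GB) (AV' _ FA') (BW _ GB')).
  by case/andP=> /eqP->.
rewrite /spectral_recursion_at; cbv zeta => recD.
have joinV (X : {set T}) (C : complex X) (K : complex (V :\ e)) :
    faces C = family_join (faces K) (faces E) ->
    spectrum_poly R C (void X)
    = spectrum_poly R K (void (V :\ e)) * spectrum_poly R E (void W).
  by move=> CE; apply: spectrum_poly_join VeW _; rewrite !setD0.
rewrite (joinV _ _ _ delJ) (joinV _ _ _ conJ).
have -> : spectrum_poly R J (void U)
    = spectrum_poly R D (void V) * spectrum_poly R E (void W).
  by apply: spectrum_poly_join VW _; rewrite !setD0.
have -> : spectrum_poly R (deletion J e) (contraction J e)
    = spectrum_poly R (deletion D e) (contraction D e)
      * spectrum_poly R E (void W).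
  apply: spectrum_poly_join VeW _.
  by rewrite delJ conJ setD0 joinD // => F /faces_sub.
have distr (S : pzRingType) (q t a b c x : S) :
    (q * a + q * t * b + (1 - q) * c) * x
    = q * (a * x) + q * t * (b * x) + (1 - q) * (c * x).
  by rewrite !mulrDl !mulrA.
by rewrite recD; apply: distr.
Qed.

Theorem corollary4p5 (R : realType) (T : finType) (V W : {set T})
    (Delta : complex V) (Gamma : complex W) :
  [disjoint V & W] ->
  spectral_recursion R Delta ->
  spectral_recursion R Gamma ->
  spectral_recursion R (join Delta Gamma).
Proof.
move=> VW recD recG e /setUP[eV|eW].
  exact: spectral_recursion_at_join VW _ eV (recD e eV).
have WV : [disjoint W & V] by rewrite disjoint_sym.
(* For a vertex of [W] the factors exchange roles; it remains to see that the faces agree by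
   commutativity of union. *)
apply: (@spectral_recursion_at_join R T W V _ Gamma Delta) WV _ eW (recG e eW).
by apply/setP => H; apply/imset2P/imset2P => -[F G FA GB ->];
  exists G F => //; rewrite setUC.
Qed.
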